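(* Let $N\ge2$ and let $(X_0,\Phi_0)$ be a standard net in $\mathbb{R}^N$. For $\lambda>0$, let $(X_1,\Phi_1)$ be the harmonic net obtained from $(X_0,\Phi_0)$ by the slow deformation along $A_t=A(\lambda^t)$, $0\le t\le1$, where $A(\lambda)=\mathrm{diag}(\lambda,\lambda^{-1/(N-1)},\dots,\lambda^{-1/(N-1)})$. Suppose that no contractions occur in the deformation and that the energy loss ratio $R=R(X_0,\Phi_0,A_t)$ satisfies $R<1/N$. Then the permanent strain $\epsilon_0$ (with $A_1^{-1}(X_1,\Phi_1)$ as reference position) satisfies \[ \left(1-\frac{N}{N-1}R\right)^{(N-1)/2N}-1\ \le\ \epsilon_0\ \le\ (1-NR)^{-(N-1)/2N}-1 . \]
   Context: A weighted graph $X=(V,E,w)$ has a vertex set $V$, a set $E$ of oriented edges, maps $o,t\colon E\to V$ and $\iota\colon E\to E$ with $\iota^2=\mathrm{id}$, $\iota(e)\ne e$, $o(\iota(e))=t(e)$, and a weight function $w\colon E\to\mathbb{R}_{\ge0}$ with $w\circ\iota=w$. Loops and multiple edges are allowed; parallel edges may be merged by adding weights. $\deg(v)=\sum_{o(e)=v}w(e)$. $X$ is connected if the 1-complex formed by all vertices and the positive-weight edges is connected. A periodic graph is an infinite connected weighted graph with an action of $L=\mathbb{Z}^N$ by weight-preserving automorphisms such that $X\to X/L$ is a covering and $X/L=(V/L,E/L)$ is finite. A periodic realization is a map $\Phi\colon V\to\mathbb{R}^N$ with an injective homomorphism $\rho\colon L\to\mathbb{R}^N$ (period homomorphism) whose image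 is a lattice, such that $\Phi(\gamma v)=\Phi(v)+\rho(\gamma)$. A net is a pair $(X,\Phi)$ of a periodic graph and a periodic realization. $\Phi(e):=\Phi(t(e))-\Phi(o(e))$. Energy: $\mathcal{E}(X,\Phi)=\frac12\sum_{e\in E/L}w(e)\|\Phi(e)\|^2$. Local tension tensor: $\mathcal{T}(v)=\sum_{o(e)=v}w(e)\Phi(e)\Phi(e)^{\mathsf T}$; global tension tensor: $\mathcal{T}(X,\Phi)=\frac12\sum_{v\in V/L}\mathcal{T}(v)$. $\Phi$ is harmonic if it minimizes $\mathcal{E}$ among periodic realizations of $X$ with the same $\rho$ (equivalently $\sum_{o(e)=v}w(e)\Phi(e)=0$ for all $v$), and standard if it minimizes $\mathcal{E}$ among periodic realizations of $X$ with the same covolume $\mathrm{vol}(\mathbb{R}^N/\rho(L))$ (known to be equivalent to: $\Phi$ is harmonic and $\mathcal{T}(X,\Phi)$ is a scalar multiple of the identity). A matrix $A\in GL(N,\mathbb{R})$ acts by $A(X,\Phi)=(X,A\circ\Phi)$, and harmonicity is preserved. Local moves (performed $L$-equivariantly). Fix constants $\delta>0$, $K_d>0$ ($d>0$) and $p_0,p_1,p_{01}\ge0$ with $p_0+p_1+p_{01}=1$. Contraction: if $\|\Phi(v_1)-\Phi(v_0)\|\le\delta$ for two vertices not equivalent under $L$, then $v_0,v_1$ are identified to one vertex, keeping all edges and weights. Splitting: if the maximal eigenvalue of $\mathcal{T}(v)$ is $\ge K_{\deg(v)}$, with associated eigenvector $\bm{u}$, the non-loop edges originating from $v$ are divided into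 two classes $0,1$ with $\bm{u}\cdot\Phi(e)\le0$ on class $0$ and $\bm{u}\cdot\Phi(e)\ge0$ on class $1$; $v$ is replaced by $v_0,v_1$, edges of class $i$ now originate from $v_i$, and the loop on $v$, of total weight $w_{\mathrm{loop}}$, is replaced by a loop on $v_0$, a loop on $v_1$ and an edge between $v_0$ and $v_1$ of weights $p_0w_{\mathrm{loop}}$, $p_1w_{\mathrm{loop}}$, $p_{01}w_{\mathrm{loop}}$. Slow deformation along a continuous family $A_t\in SL(N,\mathbb{R})$, $0\le t\le1$, $A_0=\mathrm{id}$: start with $(X_0,\Phi_0)$, with period homomorphism $\rho_0$, not satisfying the condition of any local move, and put $\rho_t=A_t\circ\rho_0$. As $t$ increases, the current graph is realized by the linearly transformed harmonic realization with period homomorphism $\rho_t$. At the first $t$ at which the condition of a local move holds, one local move is applied, and the new graph is given a harmonic realization with period homomorphism $\rho_t$; this is repeated at the same $t$ until no condition holds; then $t$ is increased again, and so on up to $t=1$. It is assumed that only finitely many local moves occur. The result is a harmonic net $(X_1,\Phi_1)$ with period homomorphism $\rho_1$. Energy loss ratio: $R(X_0,\Phi_0,A_t)=\dfrac{\mathcal{E}(X_0,\Phi_0)-\mathcal{E}(A_1^{-1}(X_1,\Phi_1))}{\mathcal{E}(X_0,\Phi_0)}$. Permanent strain: write $(\tau_{ij})=\mathcal{T}(A_1^{-1}(X_1,\Phi_1))$ and $\mathcal{V}=\mathrm{vol}(\mathbb{R}^N/\rho_0(L))$. The engineering stress, as a function of $\mu>0$, is $\sigma_{\mathrm{eng}}(\mu)=\frac{2}{\mathcal{V}\mu}\left(\tau_{11}\mu^2-\frac{1}{N-1}(\tau_{22}+\dots+\tau_{NN})\mu^{-2/(N-1)}\right)$,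 and $\epsilon_0>-1$ is the number with $\sigma_{\mathrm{eng}}(1+\epsilon_0)=0$. *)

(* Defs.v *)
From Stdlib Require Export Relation_Operators.
From mathcomp Require Export all_boot all_order all_algebra.
From mathcomp Require Export all_classical all_reals all_analysis.
Set Implicit Arguments.
Unset Strict Implicit.
Unset Printing Implicit Defensive.
Import Order.TTheory GRing.Theory Num.Theory.
Local Open Scope classical_set_scope.
Local Open Scope ring_scope.

Section Orbits.
Variables (L T : Type) (act : L -> T -> T).

Definition orbit (x : T) : set T := range (act ^~ x).

Definition orbits : set (set T) := range orbit.

(* Sum over T/L of an L-invariant f : such an f has a single value on each
   orbit C, and [xget 0 (f @` C)] is that value. *)
Definition orbit_sum (M : zmodType) (f : T -> M) : M :=
  \sum_(C \in orbits) xget 0 (f @` C).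

End Orbits.

(* The sup norm is the default norm on matrices, hence these definitions. *)
Section Euclidean.
Variables (R : realType) (N : nat).
Implicit Types u v : 'cV[R]_N.

Definition dotv u v : R := \sum_i u i 0 * v i 0.

Definition enorm u : R := Num.sqrt (dotv u u).

Definition is_max_eigenvalue (M : 'M[R]_N) (a : R) : Prop :=
  eigenvalue M a /\ forall b, eigenvalue M b -> b <= a.

Definition is_lattice (S : set 'cV[R]_N) : Prop :=
  exists2 B : 'M[R]_N, B \in unitmx &
    S = range (fun z : 'cV[int]_N => B *m map_mx intr z).

End Euclidean.

Record weighted_graph (R : realType) := WeightedGraph {
  vertex : choiceType;
  edge : choiceType;
  org : edge -> vertex;
  ter : edge -> vertex;
  rev_edge : edge -> edge;
  weight : edge -> R;
  rev_edgeK : involutive rev_edge;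
  rev_edge_neq : forall e, rev_edge e <> e;
  org_rev_edge : forall e, org (rev_edge e) = ter e;
  weight_ge0 : forall e, 0 <= weight e;
  weight_rev_edge : forall e, weight (rev_edge e) = weight e }.

Arguments org {R w} e : rename.
Arguments ter {R w} e : rename.
Arguments rev_edge {R w} e : rename.
Arguments weight {R w} e : rename.

Section WeightedGraph.
Variables (R : realType) (X : weighted_graph R).

Definition deg (v : vertex X) : R := \sum_(e \in [set e | org e = v]) weight e.

Definition adjacent (x y : vertex X) : Prop :=
  exists e : edge X, [/\ 0 < weight e, org e = x & ter e = y].

Definition connected_graph : Prop :=
  forall x y : vertex X, clos_refl_trans (vertex X) adjacent x y.

(* Total weight of the unoriented loops at v: an unoriented loop is a pair
   {e, rev_edge e} of oriented edges, both originating from v. *)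
Definition loop_weight (v : vertex X) : R :=
  2^-1 * \sum_(e \in [set e | org e = v /\ ter e = v]) weight e.

End WeightedGraph.

(* Given an action by automorphisms, X -> X/L is onto on vertices, edges and
   stars. It is a covering of graphs when, moreover, X/L is a graph, that is,
   its edge reversal has no fixed point ([act_no_inversion]), and the map from
   the star of a vertex to the star of its image is injective
   ([act_star_inj]). *)
Record periodic_graph (R : realType) (N : nat) := PeriodicGraph {
  pgraph :> weighted_graph R;
  actV : 'cV[int]_N -> vertex pgraph -> vertex pgraph;
  actE : 'cV[int]_N -> edge pgraph -> edge pgraph;
  actV0 : forall v, actV 0 v = v;
  actVD : forall g h v, actV (g + h) v = actV g (actV h v);
  actE0 : forall e, actE 0 e = e;
  actED : forall g h e, actE (g + h) e = actE g (actE h e);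
  act_org : forall g e, org (actE g e) = actV g (org e);
  act_ter : forall g e, ter (actE g e) = actV g (ter e);
  act_rev_edge : forall g e, rev_edge (actE g e) = actE g (rev_edge e);
  act_weight : forall g e, weight (actE g e) = weight e;
  act_no_inversion : forall g e, actE g e <> rev_edge e;
  act_star_inj : forall g e, org (actE g e) = org e -> actE g e = e;
  infinite_vertex : infinite_set [set: vertex pgraph];
  connected_pgraph : connected_graph pgraph;
  finite_vertex_orbits : finite_set (orbits actV);
  finite_edge_orbits : finite_set (orbits actE) }.

Arguments actV {R N p} _ _ : rename.
Arguments actE {R N p} _ _ : rename.

Section Realizations.
Variables (R : realType) (N : nat).
Implicit Types (X : periodic_graph R N) (rho : 'cV[int]_N -> 'cV[R]_N).

Definition is_period_hom rho : Prop :=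
  [/\ {morph rho : g h / g + h}, injective rho & is_lattice (range rho)].

Definition covolume rho : R :=
  `| \det (\matrix_(i, j) rho (delta_mx j 0) i 0) |.

Definition periodic_realization X rho (Phi : vertex X -> 'cV[R]_N) : Prop :=
  is_period_hom rho /\ forall g v, Phi (actV g v) = Phi v + rho g.

Definition edge_vec X (Phi : vertex X -> 'cV[R]_N) (e : edge X) : 'cV[R]_N :=
  Phi (ter e) - Phi (org e).

Definition energy X (Phi : vertex X -> 'cV[R]_N) : R :=
  2^-1 * orbit_sum (@actE R N X)
           (fun e => weight e * enorm (edge_vec Phi e) ^+ 2).

Definition local_tension X (Phi : vertex X -> 'cV[R]_N) (v : vertex X)
    : 'M[R]_N :=
  \sum_(e \in [set e | org e = v])
     weight e *: (edge_vec Phi e *m (edge_vec Phi e)^T).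

Definition tension X (Phi : vertex X -> 'cV[R]_N) : 'M[R]_N :=
  2^-1 *: orbit_sum (@actV R N X) (local_tension Phi).

Definition harmonic X rho (Phi : vertex X -> 'cV[R]_N) : Prop :=
  periodic_realization rho Phi /\
  forall Phi' : vertex X -> 'cV[R]_N,
    periodic_realization rho Phi' -> energy Phi <= energy Phi'.

Definition standard X rho (Phi : vertex X -> 'cV[R]_N) : Prop :=
  periodic_realization rho Phi /\
  forall rho' (Phi' : vertex X -> 'cV[R]_N),
    periodic_realization rho' Phi' -> covolume rho' = covolume rho ->
    energy Phi <= energy Phi'.

Definition lin_act X (A : 'M[R]_N) (Phi : vertex X -> 'cV[R]_N)
    : vertex X -> 'cV[R]_N :=
  fun v => A *m Phi v.

End Realizations.

Record move_constants (R : realType) := MoveConstants {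
  delta : R;
  Kbound : R -> R;
  p0 : R;
  p1 : R;
  p01 : R;
  delta_gt0 : 0 < delta;
  Kbound_gt0 : forall d, 0 < d -> 0 < Kbound d;
  p0_ge0 : 0 <= p0;
  p1_ge0 : 0 <= p1;
  p01_ge0 : 0 <= p01;
  p_sum1 : p0 + p1 + p01 = 1 }.

Variant move_kind := Contraction | Splitting.

Definition is_contraction (m : move_kind) : bool :=
  if m is Contraction then true else false.

Section Moves.
Variables (R : realType) (N : nat) (c : move_constants R).
Implicit Types X Y : periodic_graph R N.

(* Up to an equivariant bijection, f is the quotient map identifying
   g v0 with g v1 for every g, and making no other identification. *)
Definition identifies X Y (f : vertex X -> vertex Y) (v0 v1 : vertex X)
    : Prop :=
  [/\ forall y, exists x, f x = y,
      forall g x, f (actV g x) = actV g (f x) &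
      forall x y, f x = f y <->
        x = y \/ exists g, (x = actV g v0 /\ y = actV g v1)
                        \/ (x = actV g v1 /\ y = actV g v0)].

Definition contraction_cond X (Phi : vertex X -> 'cV[R]_N)
    (v0 v1 : vertex X) : Prop :=
  ~ orbit actV v0 v1 /\ enorm (Phi v1 - Phi v0) <= delta c.

Definition contracts_to X (v0 v1 : vertex X) Y : Prop :=
  exists (f : vertex X -> vertex Y) (k : edge X -> edge Y),
    [/\ identifies f v0 v1,
        bijective k,
        forall g e, k (actE g e) = actE g (k e),
        forall e, k (rev_edge e) = rev_edge (k e) &
        forall e, org (k e) = f (org e) /\ weight (k e) = weight e].

Definition splitting_cond X (Phi : vertex X -> 'cV[R]_N) (v : vertex X)
    (a : R) : Prop :=
  is_max_eigenvalue (local_tension Phi v) a /\ Kbound c (deg v) <= a.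

Definition loop_over X (v : vertex X) : set (edge X) :=
  [set e | org e = ter e /\ orbit actV v (org e)].

(* The L-invariant function [cls] gives the class of the edges originating
   from the orbit of v (false for class 0, true for class 1). As [ter] is
   [org] of the reversed edge, the end points of the edge [k e] of Y replacing
   e are determined by [cls e] and [cls (rev_edge e)]. The loops at v are
   replaced by l0, l1 and b; these have weight 0 if there is no loop at v. *)
Definition splits_to X (Phi : vertex X -> 'cV[R]_N) (v : vertex X)
    (u : 'cV[R]_N) Y : Prop :=
  exists (cls : edge X -> bool) (v0 v1 : vertex Y)
         (f : vertex Y -> vertex X) (k : edge X -> edge Y)
         (l0 l1 b : edge Y),
  let kept := ~` loop_over v in
  let created := orbit actE l0 `|` orbit actE (rev_edge l0) `|`
                 orbit actE l1 `|` orbit actE (rev_edge l1) `|`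
                 orbit actE b `|` orbit actE (rev_edge b) in
  [/\ (forall g e, cls (actE g e) = cls e) /\
      (forall e, org e = v -> ter e <> v ->
         if cls e then 0 <= dotv u (edge_vec Phi e)
         else dotv u (edge_vec Phi e) <= 0),
      [/\ identifies f v0 v1, v0 <> v1, f v0 = v & f v1 = v],
      [/\ set_bij kept (~` created) k,
          forall g e, kept e -> k (actE g e) = actE g (k e),
          forall e, kept e -> k (rev_edge e) = rev_edge (k e),
          forall e, kept e -> weight (k e) = weight e &
          forall e, kept e -> f (org (k e)) = org e /\
            forall g, org e = actV g v ->
              org (k e) = actV g (if cls e then v1 else v0)],
      [/\ org l0 = v0 /\ ter l0 = v0, org l1 = v1 /\ ter l1 = v1
        & org b = v0 /\ ter b = v1] &
      [/\ weight l0 = p0 c * loop_weight v,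
          weight l1 = p1 c * loop_weight v
        & weight b = p01 c * loop_weight v]].

Definition no_move X (Phi : vertex X -> 'cV[R]_N) : Prop :=
  (forall v0 v1, ~ contraction_cond Phi v0 v1) /\
  (forall v a, ~ splitting_cond Phi v a).

Variant local_move X (Phi : vertex X -> 'cV[R]_N) Y : move_kind -> Prop :=
| MoveContraction v0 v1 :
    contraction_cond Phi v0 v1 -> contracts_to v0 v1 Y ->
    local_move Phi Y Contraction
| MoveSplitting v a u :
    splitting_cond Phi v a ->
    u != 0 -> local_tension Phi v *m u = a *: u ->
    splits_to Phi v u Y ->
    local_move Phi Y Splitting.

Variables (A : R -> 'M[R]_N) (X0 : periodic_graph R N).
Variables (rho0 : 'cV[int]_N -> 'cV[R]_N) (Phi0 : vertex X0 -> 'cV[R]_N).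

(* [slow_path t X Phi ms]: the net (X, Phi) is reached at time t, after the
   local moves ms (the most recent one first). *)
Inductive slow_path :
  R -> forall X : periodic_graph R N,
    (vertex X -> 'cV[R]_N) -> seq move_kind -> Prop :=
| SlowStart : slow_path 0 Phi0 [::]
| SlowFlow s t X (Phi : vertex X -> 'cV[R]_N) ms :
    slow_path s Phi ms -> s <= t <= 1 ->
    (forall r, s <= r < t -> no_move (lin_act (A r *m invmx (A s)) Phi)) ->
    slow_path t (lin_act (A t *m invmx (A s)) Phi) ms
| SlowMove t X (Phi : vertex X -> 'cV[R]_N) ms m
    Y (Psi : vertex Y -> 'cV[R]_N) :
    slow_path t Phi ms -> local_move Phi Y m ->
    harmonic (fun g => A t *m rho0 g) Psi ->
    slow_path t Psi (m :: ms).

Definition slow_deformation X1 (Phi1 : vertex X1 -> 'cV[R]_N)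
    (ms : seq move_kind) : Prop :=
  [/\ harmonic rho0 Phi0, no_move Phi0, slow_path 1 Phi1 ms & no_move Phi1].

End Moves.

Section Strain.
Variables (R : realType) (N : nat).

Definition energy_loss_ratio (X0 : periodic_graph R N)
    (Phi0 : vertex X0 -> 'cV[R]_N) (A : R -> 'M[R]_N)
    (X1 : periodic_graph R N) (Phi1 : vertex X1 -> 'cV[R]_N) : R :=
  (energy Phi0 - energy (lin_act (invmx (A 1)) Phi1)) / energy Phi0.

Variable i0 : 'I_N.

Definition stretch (lambda : R) : 'M[R]_N :=
  diag_mx (\row_i if i == i0 then lambda
                  else lambda `^ (- (N%:R - 1)^-1)).

Definition eng_stress (vol : R) (tau : 'M[R]_N) (mu : R) : R :=
  2 / (vol * mu) *
  (tau i0 i0 * mu ^+ 2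
   - (N%:R - 1)^-1 * (\sum_(i | i != i0) tau i i)
     * mu `^ (- 2 / (N%:R - 1))).

Definition is_permanent_strain (vol : R) (tau : 'M[R]_N) (eps : R) : Prop :=
  -1 < eps /\ eng_stress vol tau (1 + eps) = 0.

End Strain.

(* Main.v *)
(* Splitting a vertex does not lengthen any edge: the old realization,
   composed with the projection of the new vertices onto the old ones, gives
   length zero to the created edges.  The harmonic realization minimizes the
   energy of each coordinate separately, hence, pulled back to the initial
   periods, no diagonal entry of the tension tensor increases along the
   deformation.  As the initial net is standard, its diagonal entries, averaged
   over the transverse directions, equal E / N, and the trace of the final
   tensor is (1 - loss) * E; this bounds the ratio of axial to transverse
   tension, a power of which is 1 + eps0. *)
Require Import Defs.
From mathcomp Require Import ring lra.
Set Implicit Arguments.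
Unset Strict Implicit.
Unset Printing Implicit Defensive.
Import Order.TTheory GRing.Theory Num.Theory.
Import numFieldNormedType.Exports.
Local Open Scope classical_set_scope.
Local Open Scope ring_scope.

(** * Sums over orbits, computed on transversals *)

Section OrbitSums.
Variables (L : zmodType) (T : choiceType) (act : L -> T -> T).
Hypothesis act0 : forall x, act 0 x = x.
Hypothesis actD : forall g h x, act (g + h) x = act g (act h x).

Lemma orbit_refl x : orbit act x x.
Proof. by exists 0. Qed.

Lemma orbit_eqP x y : orbit act x = orbit act y <-> exists g, y = act g x.
Proof.
split=> [xy|[g ->]].
  by have := orbit_refl y; rewrite -xy => -[g _ <-]; exists g.
apply/seteqP; split=> z [h _ <-] /=; last by exists (h + g).
by exists (h - g) => //=; rewrite -actD subrK.
Qed.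

(** The points that [xget] picks from the orbits form a transversal. Orbits are nonempty, so the
    default passed to [xget] is immaterial and the choice depends on the orbit alone ([xgetE]). *)
Lemma orbit_transversal :
  exists D : set T, set_inj D (orbit act) /\
    forall x, exists2 d, D d & orbit act x = orbit act d.
Proof.
have xgetE x y : xget x (orbit act x) = xget y (orbit act x).
  rewrite /xget; case: pselect => // n; exfalso; apply: n.
  by exists x; apply/asboolP/orbit_refl.
have xget_orbit x : orbit act (xget x (orbit act x)) = orbit act x.
  by have [g _ gx] := xgetI x (orbit_refl x); apply/esym/orbit_eqP; exists g.
exists [set x | xget x (orbit act x) = x]; split=> [x y|x].
  by rewrite !inE /= => xx yy xy; rewrite -[LHS]xx -[RHS]yy -xy; apply: xgetE.
exists (xget x (orbit act x)); last by rewrite xget_orbit.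
by rewrite /= xget_orbit; apply/esym/xgetE.
Qed.

Lemma orbit_inj_finite (D : set T) :
  finite_set (orbits act) -> set_inj D (orbit act) -> finite_set D.
Proof.
move=> fO Dinj; rewrite -(eq_finite_set (inj_card_eq Dinj)).
by apply: sub_finite_set fO => _ [x _ <-]; exists x.
Qed.

(** [D] has to meet only the orbits on which [f] is nonzero. This slack is what later lets loops and
    the edges created by a splitting be left out. *)
Lemma orbit_sumE (M : zmodType) (f : T -> M) (D : set T) :
  (forall g x, f (act g x) = f x) -> set_inj D (orbit act) ->
  (forall x, f x != 0 -> exists2 d, D d & orbit act x = orbit act d) ->
  orbit_sum act f = \sum_(x \in D) f x.
Proof.
move=> finv Dinj Drep.
have valE x : xget 0 (f @` orbit act x) = f x.
  apply: xget_unique => [|_ [y [g _ <-] <-]]; last exact: finv.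
  by exists x => //; apply: orbit_refl.
rewrite /orbit_sum -(@fsbig_widen _ _ _ _ (orbit act @` D)).
- by rewrite fsbig_image//; apply: eq_fsbigr => x _; apply: valE.
- by move=> _ [x _ <-]; exists x.
- move=> C [[x _ <-] nD] /=; rewrite valE; apply/eqP/negP => /negP fx.
  by have [d Dd xd] := Drep _ fx; apply: nD; exists d.
Qed.

End OrbitSums.

Lemma fsbig_mx_entry (R : zmodType) (m n : nat) (T : choiceType) (D : set T)
    (F : T -> 'M[R]_(m, n)) i j : finite_set D ->
  (\sum_(x \in D) F x) i j = \sum_(x \in D) F x i j.
Proof. by move=> fD; rewrite !fsbig_finite// summxE. Qed.

Section PeriodicGraphSums.
Variables (R : realType) (N : nat) (X : periodic_graph R N).

Lemma edge_transversal : exists D : set (edge X),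
  [/\ finite_set D,
      forall e, exists2 d, D d & exists g, e = actE g d &
      forall (M : zmodType) (f : edge X -> M),
        (forall g e, f (actE g e) = f e) ->
        orbit_sum actE f = \sum_(e \in D) f e].
Proof.
have [D [Dinj Drep]] := orbit_transversal (@actE0 _ _ X) (@actED _ _ X).
exists D; split=> [|e|M f finv].
- exact: (orbit_inj_finite (@finite_edge_orbits _ _ X)).
- have [d Dd de] := Drep e; exists d => //.
  exact/(orbit_eqP (@actE0 _ _ X) (@actED _ _ X)).
- by rewrite (orbit_sumE (@actE0 _ _ X) finv Dinj).
Qed.

(** The edges originating in a vertex transversal form an edge transversal: two of them in one orbit
    have equivalent, hence equal, origins, and [act_star_inj] makes them coincide. A single [D]
    serves both formulas, so a vertex sum of star sums becomes an edge sum. *)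
Lemma vertex_transversal : exists D : set (vertex X),
  (forall (M : zmodType) (f : vertex X -> M),
     (forall g v, f (actV g v) = f v) ->
     orbit_sum actV f = \sum_(v \in D) f v) /\
  (forall (M : zmodType) (F : edge X -> M),
     (forall g e, F (actE g e) = F e) ->
     orbit_sum actE F = \sum_(v \in D) \sum_(e \in [set e | org e = v]) F e).
Proof.
have [D [Dinj Drep]] := orbit_transversal (@actV0 _ _ X) (@actVD _ _ X).
have fD := orbit_inj_finite (@finite_vertex_orbits _ _ X) Dinj.
exists D; split=> [M f finv|M F Finv].
  by rewrite (orbit_sumE (@actV0 _ _ X) finv Dinj).
pose ED := [set e : edge X | D (org e)].
have EDinj : set_inj ED (orbit actE).
  move=> e e'; rewrite !inE /ED /= => De De'.
  move=> /(orbit_eqP (@actE0 _ _ X) (@actED _ _ X)) [g e'g].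
  have ge : org e' = actV g (org e) by rewrite e'g act_org.
  have oe : org e = org e'.
    apply: Dinj; rewrite ?inE//.
    by apply/(orbit_eqP (@actV0 _ _ X) (@actVD _ _ X)); exists g.
  by rewrite e'g act_star_inj// -e'g.
have fED := orbit_inj_finite (@finite_edge_orbits _ _ X) EDinj.
(* Extending each star by zero to the finite set [ED] makes the inner index set independent of [v],
   so the sums can be exchanged. *)
have -> : \sum_(v \in D) \sum_(e \in [set e | org e = v]) F e =
          \sum_(v \in D) \sum_(e \in ED) if e \in [set e | org e = v] then F e else 0.
  apply: eq_fsbigr => v; rewrite inE => Dv; rewrite -fsbig_mkcondr.
  by apply: eq_fsbigl; apply/seteqP; split=> [e /= ev|e []//]; split=> //; rewrite /ED /= ev.
rewrite exchange_fsbig// (orbit_sumE (@actE0 _ _ X) Finv EDinj).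
  apply: eq_fsbigr => e; rewrite inE => De.
  rewrite (fsbigD1 (org e))// mem_set// fsbig1 => [|v [_ ve]]; first exact/esym/addr0.
  by case: ifPn => //; rewrite inE => /esym.
move=> e _; have [d Dd /(orbit_eqP (@actV0 _ _ X) (@actVD _ _ X)) [g dg]] := Drep (org e).
exists (actE g e); first by rewrite /ED /= act_org -dg.
by apply/(orbit_eqP (@actE0 _ _ X) (@actED _ _ X)); exists g.
Qed.

End PeriodicGraphSums.

(** * Energy of a single coordinate, a diagonal entry of the tension tensor *)

Definition coord_energy (R : realType) (N : nat) (X : periodic_graph R N)
    (Phi : vertex X -> 'cV[R]_N) (i : 'I_N) : R :=
  2^-1 * orbit_sum (@actE R N X) (fun e => weight e * edge_vec Phi e i 0 ^+ 2).

Section CoordEnergy.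
Variables (R : realType) (N : nat) (X : periodic_graph R N).
Variables (rho : 'cV[int]_N -> 'cV[R]_N) (Phi : vertex X -> 'cV[R]_N).
Hypothesis Phi_act : forall g v, Phi (actV g v) = Phi v + rho g.

Lemma edge_vec_act g e : edge_vec Phi (actE g e) = edge_vec Phi e.
Proof. by rewrite /edge_vec act_ter act_org !Phi_act opprD addrACA subrr addr0. Qed.

Lemma energy_coord : energy Phi = \sum_i coord_energy Phi i.
Proof.
have [D [fD _ DE]] := edge_transversal X.
rewrite /energy /coord_energy -mulr_sumr DE; last first.
  by move=> g e; rewrite edge_vec_act act_weight.
congr (_ * _); transitivity (\sum_(i < N) \sum_(e <- finmap.enum_fset (fset_set D))
  weight e * edge_vec Phi e i 0 ^+ 2); last first.
  apply: eq_bigr => i _; rewrite DE ?fsbig_finite// => g e.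
  by rewrite edge_vec_act act_weight.
rewrite exchange_big /= fsbig_finite//; apply: eq_bigr => e _.
rewrite -mulr_sumr /enorm sqr_sqrtr /dotv.
  by congr (_ * _); apply: eq_bigr => i _; rewrite expr2.
by apply: sumr_ge0 => i _; rewrite -expr2 sqr_ge0.
Qed.

Lemma coord_energy_ge0 i : 0 <= coord_energy Phi i.
Proof.
have [D [fD _ DE]] := edge_transversal X.
rewrite /coord_energy DE; last by move=> g e; rewrite edge_vec_act act_weight.
rewrite mulr_ge0// fsbig_finite//; apply: sumr_ge0 => e _.
by rewrite mulr_ge0 ?weight_ge0 ?sqr_ge0.
Qed.

(** Each oriented edge is counted once, at its origin, in the sum of star sums; the factor one half
    is the same on both sides. *)
Lemma tension_coord i : tension Phi i i = coord_energy Phi i.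
Proof.
pose F e := weight e *: (edge_vec Phi e *m (edge_vec Phi e)^T).
have Finv g e : F (actE g e) = F e by rewrite /F edge_vec_act act_weight.
have [D [DV DE]] := vertex_transversal X.
have ltinv g v : local_tension Phi (actV g v) = local_tension Phi v.
  rewrite /local_tension (reindex_fsbig (actE g) [set e | org e = v]).
    by apply: eq_fsbigr => e _; exact: Finv.
  split=> [e /= <-|e e' _ _ ee'|e /= ev]; first exact: act_org.
    by rewrite -[e]actE0 -[e']actE0 -(addNr g) !actED ee'.
  exists (actE (- g) e); last by rewrite -actED subrr actE0.
  by rewrite /= act_org ev -actVD addNr actV0.
rewrite /tension mxE DV// /local_tension -DE// /coord_energy; congr (_ * _).
have [E [fE _ EE]] := edge_transversal X.
rewrite EE// EE; last by move=> g e; rewrite edge_vec_act act_weight.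
rewrite fsbig_mx_entry//; apply: eq_fsbigr => e _.
by rewrite !mxE big_ord1 !mxE expr2.
Qed.

(** Only coordinate [i] of [Psi] is constrained. This covers diagonal maps and, with [a = 1],
    realizations that mix the coordinates of two others. *)
Lemma coord_energyZ (Psi : vertex X -> 'cV[R]_N) (i : 'I_N) (a : R) :
  (forall v, Psi v i 0 = a * Phi v i 0) ->
  coord_energy Psi i = a ^+ 2 * coord_energy Phi i.
Proof.
move=> PsiE; have [D [fD _ DE]] := edge_transversal X.
have vE e : edge_vec Psi e i 0 = a * edge_vec Phi e i 0.
  by rewrite !mxE !PsiE mulrBr.
rewrite /coord_energy mulrCA; congr (_ * _).
rewrite !DE; last 2 first.
- by move=> g e; rewrite edge_vec_act act_weight.
- by move=> g e; rewrite !vE edge_vec_act act_weight.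
rewrite !fsbig_finite// mulr_sumr; apply: eq_bigr => e _.
by rewrite vE exprMn mulrCA.
Qed.

(** Without energy, coordinate [i] is constant along every edge of positive weight, hence on the
    whole connected graph; comparing a vertex with its translate by [g] then reads off the
    period. *)
Lemma coord_energy_eq0 i : coord_energy Phi i = 0 -> forall g, rho g i 0 = 0.
Proof.
have [D [fD Drep DE]] := edge_transversal X.
have inv g e : weight (actE g e) * edge_vec Phi (actE g e) i 0 ^+ 2 =
               weight e * edge_vec Phi e i 0 ^+ 2.
  by rewrite edge_vec_act act_weight.
rewrite /coord_energy DE// fsbig_finite// => /eqP.
rewrite mulf_eq0 invr_eq0 pnatr_eq0 /= psumr_eq0; last first.
  by move=> e _; rewrite mulr_ge0 ?weight_ge0 ?sqr_ge0.
move=> /allP e0.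
have adj x y : adjacent x y -> Phi y i 0 = Phi x i 0.
  move=> [e [we <- <-]]; have [d Dd [g ed]] := Drep e.
  have /= := e0 d; rewrite in_fset_set// mem_set// => /(_ isT).
  rewrite -(inv g) -ed mulf_eq0 (gt_eqF we) /= sqrf_eq0 !mxE.
  by rewrite subr_eq0 => /eqP.
have conn x y : clos_refl_trans (vertex X) (@adjacent _ X) x y -> Phi y i 0 = Phi x i 0.
  by elim=> [{}x {}y /adj//|//|{}x {}y z _ <- _ ->].
have [x _] := infinite_setN0 (@infinite_vertex _ _ X).
move=> g; have /= := conn _ _ (@connected_pgraph _ _ X x (actV g x)).
by rewrite Phi_act mxE => /eqP; rewrite -subr_eq0 addrAC subrr add0r => /eqP.
Qed.

End CoordEnergy.

(** * Period lattices and harmonic realizations *)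

Section Realizations.
Variables (R : realType) (N : nat).
Implicit Types (X Y : periodic_graph R N) (rho : 'cV[int]_N -> 'cV[R]_N).

Lemma realization_lin_act X (M : 'M[R]_N) rho (Phi : vertex X -> 'cV[R]_N) :
  M \in unitmx -> periodic_realization rho Phi ->
  periodic_realization (fun g => M *m rho g) (lin_act M Phi).
Proof.
move=> uM [[rhoD rho_inj [B uB rhoB]] Phi_act].
split; last by move=> g v; rewrite /lin_act Phi_act mulmxDr.
split; first by move=> g h; rewrite rhoD mulmxDr.
  by move=> g h /(can_inj (mulKmx uM)) /rho_inj.
exists (M *m B); first by rewrite unitmx_mul uM.
have -> : range (fun g => M *m rho g) = mulmx M @` range rho.
  by rewrite image_comp.
by rewrite rhoB image_comp; congr image; apply/funext => z; apply: mulmxA.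
Qed.

Lemma covolume_lin (M : 'M[R]_N) rho :
  covolume (fun g => M *m rho g) = `|\det M| * covolume rho.
Proof.
rewrite /covolume -normrM -det_mulmx; congr `|\det _|.
by apply/matrixP => i j; rewrite !mxE; apply: eq_bigr => k _; rewrite !mxE.
Qed.

Lemma period_hom_mulmx rho z : is_period_hom rho ->
  rho z = (\matrix_(i, j) rho (delta_mx j 0) i 0) *m map_mx intr z.
Proof.
move=> [rhoD _ _].
have rho0 : rho 0 = 0 by apply: (addrI (rho 0)); rewrite -rhoD !addr0.
have rhoN g : rho (- g) = - rho g.
  by apply: (addrI (rho g)); rewrite -rhoD !subrr.
have rhoMn n g : rho (g *+ n) = rho g *+ n.
  by elim: n => [|n IH]; rewrite ?mulr0n// !mulrS rhoD IH.
have rhoZ (a : int) g : rho (a *: g) = a%:~R *: rho g.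
  rewrite -[a in LHS]intz !scaler_int; case: a => n; first exact: rhoMn.
  by rewrite NegzE !mulrNz rhoN -!pmulrn rhoMn.
rewrite [z in LHS]matrix_sum_delta.
under eq_bigr do rewrite big_ord1.
rewrite (big_morph rho rhoD rho0); apply/matrixP => i j; rewrite summxE mxE.
by apply: eq_bigr => k _; rewrite rhoZ !mxE (ord1 j) mulrC.
Qed.

(** The columns of a lattice basis [B] are periods, so [B] is the period matrix [P] times an integer
    matrix, and the invertibility of [B] passes to [P]. *)
Lemma covolume_gt0 rho : is_period_hom rho -> 0 < covolume rho.
Proof.
move=> hrho; have [_ _ [B uB rhoB]] := hrho.
rewrite normr_gt0 -unitfE -unitmxE.
set P := (X in X \in unitmx).
have colB j : exists z, col j B = P *m map_mx intr z.
  have [z _ zj] : range rho (col j B).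
    rewrite rhoB; exists (delta_mx j 0) => //.
    by rewrite map_delta_mx colE.
  by exists z; rewrite -zj; apply: period_hom_mulmx.
have [Z ZB] := choice colB.
have BE : B = P *m \matrix_(i, j) (Z j i 0)%:~R.
  apply/matrixP => i j; have /matrixP/(_ i 0) := ZB j.
  by rewrite !mxE => ->; apply: eq_bigr => k _; rewrite !mxE.
by move: uB; rewrite BE unitmx_mul => /andP[].
Qed.

(** The competitor [Psi] takes coordinate [i] from [Phi'] and all others from [Phi]. It has the
    periods [rho], and in comparing its energy with that of [Phi] the other coordinates cancel. *)
Lemma harmonic_coord X rho (Phi Phi' : vertex X -> 'cV[R]_N) i :
  harmonic rho Phi -> periodic_realization rho Phi' ->
  coord_energy Phi i <= coord_energy Phi' i.
Proof.
move=> [[hrho Phi_act] Phi_min] [_ Phi'_act].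
pose Psi v : 'cV[R]_N := \col_j (if j == i then Phi' v j 0 else Phi v j 0).
have Psi_act g v : Psi (actV g v) = Psi v + rho g.
  apply/matrixP => j k; rewrite (ord1 k) !mxE Phi_act Phi'_act !mxE.
  by case: ifP.
have := Phi_min Psi (conj hrho Psi_act).
rewrite (energy_coord Phi_act) (energy_coord Psi_act).
rewrite (bigD1 i)//= [leRHS](bigD1 i)//=.
rewrite (coord_energyZ Phi'_act (Psi := Psi) (a := 1)) => [|v]; last first.
  by rewrite mxE eqxx mul1r.
rewrite expr1n mul1r.
rewrite [X in _ <= _ + X](eq_bigr (fun j => coord_energy Phi j)) ?lerD2r//.
move=> j ji; rewrite (coord_energyZ Phi_act (a := 1)) ?expr1n ?mul1r// => v.
by rewrite mxE (negbTE ji) mul1r.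
Qed.

(** If the energy vanished, so would every coordinate energy and then every period, against the
    injectivity of [rho]. *)
Lemma energy_gt0 X rho (Phi : vertex X -> 'cV[R]_N) : (0 < N)%N ->
  periodic_realization rho Phi -> 0 < energy Phi.
Proof.
move=> N0 [[rhoD rho_inj _] Phi_act]; rewrite (energy_coord Phi_act).
have ge0 i : true -> 0 <= coord_energy Phi i.
  by move=> _; apply: coord_energy_ge0.
rewrite lt_neqAle sumr_ge0// andbT; apply/eqP => /esym/(psumr_eq0P ge0) ce0.
have rho0 g : rho g = 0.
  apply/matrixP => i j; rewrite (ord1 j) mxE.
  exact: (coord_energy_eq0 Phi_act (ce0 i isT)).
have /matrixP/(_ (Ordinal N0) 0) : const_mx 1 = 0 :> 'cV[int]_N.
  by apply: rho_inj; rewrite !rho0.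
by rewrite !mxE.
Qed.

End Realizations.

(** * Splitting a vertex preserves the coordinate energies of the collapsed realization *)

Section Splitting.
Variables (R : realType) (N : nat) (c : move_constants R).
Variables (X Y : periodic_graph R N) (rho : 'cV[int]_N -> 'cV[R]_N).
Variables (Phi : vertex X -> 'cV[R]_N) (v : vertex X) (u : 'cV[R]_N).
Hypothesis Phi_act : forall g x, Phi (actV g x) = Phi x + rho g.

(** The map [f] collapses the two new vertices onto [v]. Kept edges correspond under [k] with equal
    weights and displacements, created edges get displacement zero, and the loops they replace had
    displacement zero already. *)
Lemma splits_to_coord_energy : splits_to c Phi v u Y ->
  exists2 f : vertex Y -> vertex X, forall g y, f (actV g y) = actV g (f y) &
    forall i, coord_energy (Phi \o f) i = coord_energy Phi i.
Proof.
move=> [cls [v0 [v1 [f [k [l0 [l1 [b]]]]]]]] /=.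
set kept := ~` _; set created := _ `|` orbit actE (rev_edge b).
move=> [_ [[_ fact _] _ fv0 fv1] [[kfun kinj ksurj] kact krev kw korg]].
move=> [[ol0 tl0] [ol1 tl1] [ob tb]] _.
exists f => // i.
have keptP g e : kept e -> kept (actE g e).
  move=> ke [/= oe [h _ hv]]; apply: ke; split.
    move: oe; rewrite act_org act_ter => /(congr1 (actV (- g))).
    by rewrite -!actVD addNr !actV0.
  exists (- g + h) => //=; rewrite actVD hv act_org -actVD addNr actV0//.
have kept_rev e : kept e -> kept (rev_edge e).
  move=> ke [/= oe [h _ hv]]; apply: ke.
  have te : ter (rev_edge e) = org e by rewrite -org_rev_edge rev_edgeK.
  by move: oe hv; rewrite org_rev_edge te => et hv; split; [|exists h; rewrite // hv et].
pose hX e := weight e * edge_vec Phi e i 0 ^+ 2.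
pose hY e := weight e * edge_vec (Phi \o f) e i 0 ^+ 2.
have Psi_act g y : (Phi \o f) (actV g y) = (Phi \o f) y + rho g.
  by rewrite /= fact Phi_act.
have hXact g e : hX (actE g e) = hX e.
  by rewrite /hX (edge_vec_act Phi_act) act_weight.
have hYact g e : hY (actE g e) = hY e.
  by rewrite /hY (edge_vec_act Psi_act) act_weight.
have hY_rev e : hY (rev_edge e) = hY e.
  have te : ter (rev_edge e) = org e by rewrite -org_rev_edge rev_edgeK.
  rewrite /hY weight_rev_edge /edge_vec te org_rev_edge -opprB.
  by rewrite [X in X ^+ 2]mxE sqrrN.
have hY0 e : f (org e) = f (ter e) -> hY e = 0.
  by move=> fe; rewrite /hY /edge_vec /= fe subrr mxE expr0n mulr0.
(* The splitting data locate only origins, so the terminus of [k e] is read as the origin of its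
   reversal. *)
have hYk e : kept e -> hY (k e) = hX e.
  move=> ke; have kre := kept_rev _ ke.
  rewrite /hY /hX kw// /edge_vec /=.
  rewrite -(org_rev_edge (k e)) -krev//.
  by have [-> _] := korg _ ke; have [-> _] := korg _ kre; rewrite org_rev_edge.
have hYcreated e : created e -> hY e = 0.
  by move=> [[[[[[g _ <-]|[g _ <-]]|[g _ <-]]|[g _ <-]]|[g _ <-]]|[g _ <-]];
     rewrite hYact ?hY_rev hY0// ?ol0 ?tl0 ?ol1 ?tl1 ?ob ?tb ?fv0 ?fv1.
have eqE (Z : periodic_graph R N) (x y : edge Z) :
    orbit actE x = orbit actE y <-> exists g, y = actE g x.
  exact: orbit_eqP (@actE0 _ _ Z) (@actED _ _ Z) x y.
have [D [Dinj Drep]] := orbit_transversal (@actE0 _ _ X) (@actED _ _ X).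
have DK_inj : set_inj (D `&` kept) (orbit actE).
  move=> e e'; rewrite !inE => -[De _] [De' _].
  by apply: Dinj; rewrite inE.
rewrite /coord_energy; congr (_ * _).
(* Edges that are not kept are loops and contribute zero, so the kept part of [D] represents all
   contributing orbits. *)
rewrite (@orbit_sumE _ _ _ (@actE0 _ _ X) _ hX (D `&` kept))//; last first.
  move=> e he; have [d Dd ed] := Drep e; exists d => //; split => //.
  have [g ->] := (eqE X _ _).1 ed; apply: keptP => -[/= oe _].
  by move: he; rewrite /hX /edge_vec oe subrr mxE expr0n mulr0 eqxx.
(* In [Y], an edge with nonzero contribution is not created, so it comes from a kept edge, and [k]
   carries representatives to representatives. *)
rewrite (@orbit_sumE _ _ _ (@actE0 _ _ Y) _ hY (k @` (D `&` kept)))//; last 2 first.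
- move=> _ _ /set_mem[d [Dd kd] <-] /set_mem[d' [Dd' kd'] <-].
  move=> /(eqE Y _ _)[g]; rewrite -kact// => kdd'.
  have dd' : d' = actE g d by apply: kinj => //; rewrite inE//; apply: keptP.
  by congr k; apply: Dinj; rewrite ?inE//; apply/eqE; exists g.
- move=> e' he'; have [e ke <-] : (k @` kept) e'.
    by apply: ksurj => ce'; move: he'; rewrite hYcreated ?eqxx.
  have [d Dd ed] := Drep e; have [g dg] := (eqE X _ _).1 (esym ed).
  have kd : kept d.
    have -> : d = actE (- g) e by rewrite dg -actED addNr actE0.
    exact: keptP.
  by exists (k d); [exists d|apply/eqE; exists (- g); rewrite -kact// dg -actED addNr actE0].
rewrite fsbig_image.
  by apply: eq_fsbigr => e; rewrite inE => -[_ ke]; apply: hYk.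
by move=> e e' /set_mem[_ ke] /set_mem[_ ke']; apply: kinj; rewrite inE.
Qed.

End Splitting.

(** * Coordinate energies along a slow diagonal deformation *)

Section DiagonalDeformation.
Variables (R : realType) (N : nat).
Implicit Types (X Y : periodic_graph R N) (d : 'rV[R]_N).

Lemma diag_mx_unit d : (forall i, d 0 i != 0) -> diag_mx d \in unitmx.
Proof.
by move=> d0; rewrite unitmxE det_diag unitfE; apply/prodf_neq0.
Qed.

Lemma lin_act_diag X d (Phi : vertex X -> 'cV[R]_N) x i :
  lin_act (diag_mx d) Phi x i 0 = d 0 i * Phi x i 0.
Proof. by rewrite /lin_act mul_diag_mx mxE. Qed.

Lemma invmx_diag d : (forall i, d 0 i != 0) ->
  invmx (diag_mx d) = diag_mx (\row_i (d 0 i)^-1).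
Proof.
move=> d0; apply: (can_inj (mulKmx (diag_mx_unit d0))).
rewrite mulmxV ?diag_mx_unit//; apply/matrixP => i j.
rewrite mul_diag_mx !mxE; case: eqVneq => _; rewrite ?mulr0n ?mulr0//.
by rewrite !mulr1n divff.
Qed.

(** Induction on the path. Flowing from [s] to [t] multiplies coordinate energy [i] by exactly the
    square of [d t 0 i / d s 0 i]. At a splitting, the collapsed old realization is a competitor for
    the new harmonic one, so [harmonic_coord] shows that no coordinate energy grows. *)
Lemma slow_path_coord_energy (c : move_constants R) (d : R -> 'rV[R]_N)
    X0 rho0 (Phi0 : vertex X0 -> 'cV[R]_N) t X (Phi : vertex X -> 'cV[R]_N) ms :
  let A s := diag_mx (d s) in
  (forall s i, d s 0 i != 0) -> d 0 = const_mx 1 ->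
  periodic_realization rho0 Phi0 ->
  slow_path c A rho0 Phi0 t Phi ms -> ~~ has is_contraction ms ->
  periodic_realization (fun g => A t *m rho0 g) Phi /\
  forall i, coord_energy Phi i <= d t 0 i ^+ 2 * coord_energy Phi0 i.
Proof.
move=> A dn0 d01 real0; elim=> [|s {}t {}X {}Phi {}ms _ IH _ _ /IH[realPhi cePhi]|
  {}t {}X {}Phi {}ms m Y Psi _ IH mv harmPsi].
- move=> _; have A0 : A 0 = 1%:M by rewrite /A d01 diag_const_mx.
  have -> : (fun g => A 0 *m rho0 g) = rho0.
    by apply/funext => g; rewrite A0 mul1mx.
  by split=> // i; rewrite d01 mxE expr1n mul1r.
- have Ainv : A t *m invmx (A s) = diag_mx (\row_i (d t 0 i / d s 0 i)).
    rewrite invmx_diag//; apply/matrixP => i j; rewrite mul_diag_mx !mxE.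
    by case: eqVneq => _; rewrite ?mulr0n ?mulr0// !mulr1n.
  have uA s' : A s' \in unitmx by apply: diag_mx_unit.
  split.
    have /= := realization_lin_act (M := A t *m invmx (A s)) _ realPhi.
    rewrite unitmx_mul unitmx_inv !uA => /(_ isT) [hrho Phi_act].
    have rhoE : (fun g => A t *m invmx (A s) *m (A s *m rho0 g)) =
                (fun g => A t *m rho0 g).
      by apply/funext => g; rewrite mulmxA mulmxKV.
    by rewrite rhoE in hrho; split=> // g x; rewrite Phi_act (congr1 (@^~ g) rhoE).
  move=> i; have [_ Phi_act] := realPhi.
  rewrite (coord_energyZ Phi_act (a := d t 0 i / d s 0 i)) => [|x]; last first.
    by rewrite Ainv lin_act_diag mxE.
  rewrite expr_div_n -mulrA ler_wpM2l ?sqr_ge0//.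
  rewrite ler_pdivrMl; first exact: cePhi.
  by rewrite exprn_even_gt0 //=.
- case: mv IH => [v0 v1 _ _|v a u _ _ _ spl] IH //= /IH[[hrho Phi_act] cePhi].
  split=> [|i]; first exact: harmPsi.1.
  have [f fact ceE] := splits_to_coord_energy Phi_act spl.
  apply: le_trans (cePhi i); rewrite -ceE; apply: harmonic_coord harmPsi _.
  by split=> // g y /=; rewrite fact Phi_act.
Qed.

End DiagonalDeformation.

(** * Volume-preserving stretches and the balance of a standard net *)

Section Stretch.
Variables (R : realType) (N : nat) (i0 : 'I_N).

Definition stretch_row (m : R) : 'rV[R]_N :=
  \row_i if i == i0 then m else m `^ (- (N%:R - 1)^-1).

Lemma stretch_row_gt0 m i : 0 < m -> 0 < stretch_row m 0 i.
Proof. by move=> m0; rewrite mxE; case: ifP => // _; apply: powR_gt0. Qed.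

Lemma det_stretch (m : R) : (2 <= N)%N -> 0 < m -> \det (stretch i0 m) = 1.
Proof.
move=> N2 m0; rewrite det_diag (bigD1 i0)//= mxE eqxx.
under eq_bigr => i ii0 do rewrite mxE (negbTE ii0).
rewrite prodr_const cardC1 card_ord -powR_mulrn ?powR_ge0// -powRrM.
have -> : N.-1%:R = N%:R - 1 :> R by rewrite -subn1 natrB// ltnW.
rewrite mulNr mulVf ?powR_inv1 ?divff ?gt_eqF ?ltW//.
by rewrite subr_gt0 ltr1n.
Qed.

End Stretch.

Lemma deriv_horner_min (R : realType) (p : {poly R}) (x : R) : 0 < x ->
  (forall y, 0 < y -> p.[x] <= p.[y]) -> p^`().[x] = 0.
Proof.
move=> x0 pmin.
(* The interval from [0] to [2x] is an open neighbourhood of [x] on which the minimality hypothesis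
   applies. *)
have x2 : x \in `]0, x + x[%R by rewrite in_itv /= x0 ltrDl.
have dp : is_derive x 1 (horner p) 0.
  apply: (@derive1_at_min R _ 0 (x + x)) x2 _.
  - by rewrite addr_ge0// ltW.
  - by move=> y _; apply: derivable_horner.
  - by move=> y; rewrite in_itv => /andP[y0 _]; apply: pmin.
have dp' := is_derive_poly p x.
by rewrite -(@derive_val _ _ _ _ _ _ _ dp') (@derive_val _ _ _ _ _ _ _ dp).
Qed.

(** This is the first-order condition for minimality among the stretches along [i0], which preserve
    the covolume: at the identity the derivative of the energy in the stretch parameter vanishes. *)
Lemma standard_coord_energy (R : realType) (N : nat) (i0 : 'I_N)
    (X : periodic_graph R N) rho (Phi : vertex X -> 'cV[R]_N) :
  (2 <= N)%N -> standard rho Phi ->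
  (N%:R - 1) * coord_energy Phi i0 = \sum_(i | i != i0) coord_energy Phi i.
Proof.
move=> N2 [realPhi Phi_min]; have [_ Phi_act] := realPhi.
set a := coord_energy Phi i0; set S := \sum_(i | _) _.
have n0 : 0 < N%:R - 1 :> R by rewrite subr_gt0 ltr1n.
have ineq x : 0 < x -> a + S <= x ^+ N.-1 * a + x^-1 * S.
  (* With this [m], the axial energy is multiplied by [m ^+ 2 = x ^+ N.-1] and the transverse one by
     [x^-1]: no real exponents remain. *)
  move=> x0; pose m := x `^ ((N%:R - 1) / 2); have m0 : 0 < m by apply: powR_gt0.
  have uA : stretch i0 m \in unitmx by rewrite unitmxE det_stretch ?unitr1.
  have realA := realization_lin_act uA realPhi; have [_ A_act] := realA.
  have := Phi_min _ _ realA; rewrite covolume_lin det_stretch// normr1 mul1r.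
  move=> /(_ erefl); rewrite (energy_coord Phi_act) (energy_coord A_act).
  rewrite (bigD1 i0)//= [leRHS](bigD1 i0)//= -/a -/S => /le_trans; apply.
  rewrite le_eqVlt; apply/orP; left; apply/eqP; congr (_ + _).
    rewrite (coord_energyZ Phi_act (a := m)); last first.
      by move=> v; rewrite lin_act_diag mxE eqxx.
    congr (_ * _); rewrite -powR_mulrn ?ltW// -powRrM divfK ?pnatr_eq0//.
    by rewrite -(natrB _ (ltnW N2)) subn1 powR_mulrn ?ltW.
  rewrite mulr_sumr; apply: eq_bigr => i ii0.
  rewrite (coord_energyZ Phi_act (a := m `^ (- (N%:R - 1)^-1))); last first.
    by move=> v; rewrite lin_act_diag mxE (negbTE ii0).
  congr (_ * _); rewrite -powR_mulrn ?powR_ge0// -!powRrM -(powR_inv1 (ltW x0)).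
  by congr (_ `^ _); field; rewrite gt_eqF.
clearbody a S.
(* Multiplying [ineq] by [x] turns it into nonnegativity of this polynomial, which vanishes at [1];
   its derivative there is [N a - (a + S)]. *)
pose p : {poly R} := a *: 'X^N + S%:P - (a + S) *: 'X.
have pE y : p.[y] = a * y ^+ N + S - (a + S) * y by rewrite /p !hornerE.
have pmin y : 0 < y -> p.[1] <= p.[y].
  move=> y0; rewrite !pE expr1n !mulr1 subrr subr_ge0.
  move: (ineq y y0) => /(ler_wpM2r (ltW y0))/le_trans; apply.
  have -> : y ^+ N = y * y ^+ N.-1 by rewrite -exprS prednK// ltnW.
  by rewrite le_eqVlt; apply/orP; left; apply/eqP; field; rewrite gt_eqF.
have := deriv_horner_min ltr01 pmin.
rewrite derivB derivD derivC !derivZ derivX derivXn.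
rewrite !hornerE hornerMn hornerXn expr1n => h.
by rewrite mulrBl mul1r; lra.
Qed.

(** * From tension bounds to the permanent strain *)

Lemma tension_ratio_bounds (R : realFieldType) (n E a S r : R) :
  2 <= n -> 0 < E -> a + S = (1 - r) * E ->
  n * a <= E -> n * S <= (n - 1) * E -> r < n^-1 ->
  [/\ 0 < a, 0 < S, 0 < 1 - n / (n - 1) * r,
      1 - n / (n - 1) * r <= S / ((n - 1) * a) &
      S / ((n - 1) * a) <= (1 - n * r)^-1].
Proof.
move=> n2 E0 aS aE SE rn.
have n0 : 0 < n by lra.
have n10 : 0 < n - 1 by lra.
have nr1 : n * r < 1 by rewrite mulrC -ltr_pdivlMr// mul1r.
(* The sum of the two tensions is known, so the upper bound on each yields a lower bound on the
   other; the extreme ratios pair one upper with one lower bound. *)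
have nE : n * a + n * S = E - n * r * E + (n - 1) * E.
  by rewrite -mulrDr aS; ring.
have a_low : (1 - n * r) * E <= n * a by lra.
have S_low : (n - 1 - n * r) * E <= n * S by lra.
have a0 : 0 < a.
  by rewrite -(pmulr_rgt0 _ n0) (lt_le_trans _ a_low)// mulr_gt0// subr_gt0.
have S0 : 0 < S.
  by rewrite -(pmulr_rgt0 _ n0) (lt_le_trans _ S_low)// mulr_gt0//; lra.
have lowE : 1 - n / (n - 1) * r = (n - 1 - n * r) / (n - 1).
  by field; rewrite gt_eqF.
split=> //.
- by rewrite lowE divr_gt0//; lra.
- rewrite lowE ler_pdivlMr ?mulr_gt0// mulrA divfK ?gt_eqF//.
  rewrite -(ler_pM2l n0) (le_trans _ S_low)// mulrCA ler_wpM2l//; lra.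
- rewrite ler_pdivrMr ?mulr_gt0// ler_pdivlMl; last by lra.
  rewrite -(ler_pM2l n0) mulrCA (le_trans (y := (1 - n * r) * ((n - 1) * E)))//.
    by rewrite ler_wpM2l//; lra.
  by rewrite mulrCA [leRHS]mulrCA ler_pM2l.
Qed.

(** The stress is a positive factor times [mu] to the power [k^-1] minus [q], so it has exactly one
    positive zero, [q] to the power [k]. *)
Lemma permanent_strainE (R : realType) (N : nat) (i0 : 'I_N) (vol : R)
    (tau : 'M[R]_N) (eps : R) :
  let S := \sum_(i | i != i0) tau i i in
  (2 <= N)%N -> 0 < vol -> 0 < tau i0 i0 -> 0 < S ->
  is_permanent_strain i0 vol tau eps <->
  eps = (S / ((N%:R - 1) * tau i0 i0)) `^ ((N%:R - 1) / (2 * N%:R)) - 1.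
Proof.
move=> S N2 vol0 a0 S0; set n := N%:R : R; set a := tau i0 i0 in a0 *.
have n2 : 2 <= n by rewrite ler_nat.
have n10 : 0 < n - 1 by lra.
set q := S / _; have q0 : 0 < q by rewrite divr_gt0 ?mulr_gt0.
set k := (n - 1) / (2 * n).
have k0 : 0 < k by rewrite divr_gt0//; lra.
have stress0 mu : 0 < mu ->
    eng_stress i0 vol tau mu = 0 <-> mu = q `^ k.
  move=> mu0; rewrite /eng_stress -/a -/S -/n.
  set b := - 2 / (n - 1).
  have mub0 : 0 < mu `^ b by apply: powR_gt0.
  (* The exponents add up to two: [k^-1 = 2n / (n - 1)] and [b = - 2 / (n - 1)]. *)
  have kV : mu `^ (k^-1) * mu `^ b = mu ^+ 2.
    rewrite -powRD ?(gt_eqF mu0) ?implybT// -powR_mulrn ?ltW//.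
    by congr (_ `^ _); rewrite /k /b; field; rewrite !gt_eqF//; lra.
  have -> : (n - 1)^-1 * S = a * q by rewrite /q; field; rewrite !gt_eqF.
  rewrite -kV.
  have -> : a * (mu `^ k^-1 * mu `^ b) - a * q * mu `^ b =
            a * mu `^ b * (mu `^ k^-1 - q) by ring.
  split=> [/eqP|->]; last first.
    by rewrite -(powRrM q k k^-1) (divff (lt0r_neq0 k0)) powRr1 ?ltW// subrr !mulr0.
  have c0 : 2 / (vol * mu) * (a * mu `^ b) != 0.
    by rewrite lt0r_neq0// mulr_gt0 ?divr_gt0 ?mulr_gt0.
  rewrite mulrA mulf_eq0 (negbTE c0) subr_eq0 => /eqP <-.
  by rewrite -(powRrM mu k^-1 k) (mulVf (lt0r_neq0 k0)) powRr1 ?ltW.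
have qk0 : 0 < q `^ k by apply: powR_gt0.
split=> [[eps1 seps]|->].
  have /(stress0 _) [/(_ seps) <- _] : 0 < 1 + eps by rewrite addrC -ltrBlDr sub0r.
  by rewrite addrC addKr.
split; first by rewrite ltrBrDr addNr.
by rewrite addrC subrK; apply/(stress0 _ qk0).
Qed.

Theorem proposition8p2 (R : realType) (N : nat) (N2 : (2 <= N)%N)
    (c : move_constants R)
    (X0 : periodic_graph R N) (rho0 : 'cV[int]_N -> 'cV[R]_N)
    (Phi0 : vertex X0 -> 'cV[R]_N) (lambda : R)
    (X1 : periodic_graph R N) (Phi1 : vertex X1 -> 'cV[R]_N)
    (moves : seq move_kind) :
  let i0 : 'I_N := Ordinal (ltnW N2) in
  let A : R -> 'M[R]_N := fun t => stretch i0 (lambda `^ t) in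
  let loss : R := energy_loss_ratio Phi0 A Phi1 in
  let tau : 'M[R]_N := tension (lin_act (invmx (A 1)) Phi1) in
  standard rho0 Phi0 ->
  0 < lambda ->
  slow_deformation c A rho0 Phi0 Phi1 moves ->
  ~~ has is_contraction moves ->
  loss < N%:R^-1 ->
  exists eps0 : R,
    unique (is_permanent_strain i0 (covolume rho0) tau) eps0 /\
    (1 - N%:R / (N%:R - 1) * loss) `^ ((N%:R - 1) / (2 * N%:R)) - 1 <= eps0
      <= (1 - N%:R * loss) `^ (- ((N%:R - 1) / (2 * N%:R))) - 1.
Proof.
move=> i0 A loss tau std0 lambda0 [_ _ path01 _] no_contr loss_lt.
have [real0 _] := std0; have [_ Phi0_act] := real0.
(* By conversion [A s] is [diag_mx (d s)], so the results on diagonal deformations apply. *)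
pose d s := stretch_row i0 (lambda `^ s).
have d0 s i : d s 0 i != 0 by rewrite gt_eqF// stretch_row_gt0// powR_gt0.
have [real1 ce1] : periodic_realization (fun g => A 1 *m rho0 g) Phi1 /\
    forall i, coord_energy Phi1 i <= d 1 0 i ^+ 2 * coord_energy Phi0 i.
  apply: slow_path_coord_energy path01 no_contr => //.
  apply/matrixP => i j; rewrite !mxE powRr0 powR1.
  by case: ifP.
have [_ Phi1_act] := real1.
have uA : A 1 \in unitmx := diag_mx_unit (d0 1).
have [_ Psi_act] : periodic_realization (fun g => invmx (A 1) *m (A 1 *m rho0 g))
    (lin_act (invmx (A 1)) Phi1).
  by apply: realization_lin_act real1; rewrite unitmx_inv.
have tauE i : tau i i = coord_energy (lin_act (invmx (A 1)) Phi1) i.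
  exact: (tension_coord Psi_act).
(* Pulling back by the inverse of [A 1] divides coordinate energy [i] by the square of [d 1 0 i],
   cancelling the factor in [ce1]. *)
have tau_le i : tau i i <= coord_energy Phi0 i.
  rewrite tauE (coord_energyZ Phi1_act (a := (d 1 0 i)^-1)) => [|v]; last first.
    by rewrite (invmx_diag (d0 1) : invmx (A 1) = _) lin_act_diag mxE.
  by rewrite exprVn ler_pdivrMl ?exprn_even_gt0//= ce1.
pose n : R := N%:R.
have n2 : 2 <= n by rewrite ler_nat.
have E0 : 0 < energy Phi0 by apply: energy_gt0 real0; apply: ltnW.
pose S := \sum_(i | i != i0) tau i i.
have aS : tau i0 i0 + S = (1 - loss) * energy Phi0.
  rewrite /loss /energy_loss_ratio (energy_coord Psi_act).
  rewrite (bigD1 i0)//= -tauE (eq_bigr _ (fun i _ => esym (tauE i))) -/S.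
  by field; rewrite gt_eqF.
have bal := standard_coord_energy i0 N2 std0.
(* By the balance [bal], the axial coordinate carries exactly the fraction [1/n] of the initial
   energy and the transverse ones the rest. *)
have sumE : energy Phi0 = n * coord_energy Phi0 i0.
  by rewrite (energy_coord Phi0_act) (bigD1 i0)//= -bal; ring.
have aE : n * tau i0 i0 <= energy Phi0 by rewrite sumE ler_wpM2l// ler0n.
have SE : n * S <= (n - 1) * energy Phi0.
  rewrite sumE mulrCA bal ler_wpM2l ?ler0n//.
  by apply: ler_sum => i _; apply: tau_le.
have [a0 S0 low0 low up] := tension_ratio_bounds n2 E0 aS aE SE loss_lt.
have k0 : 0 <= (n - 1) / (2 * n) by rewrite divr_ge0//; lra.
have vol0 : 0 < covolume rho0 by apply: covolume_gt0 real0.1.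
have strainE eps := permanent_strainE eps N2 vol0 a0 S0.
exists ((S / ((n - 1) * tau i0 i0)) `^ ((n - 1) / (2 * n)) - 1); split.
  by split=> [|eps /strainE ->//]; apply/strainE.
have q0 := lt_le_trans low0 low.
(* Positivity of the inverse gives [0 <= 1 - n * loss], which is needed to trade the negative
   exponent for an inverted base. The bounds on the ratio then pass through the monotone power. *)
have up0 := lt_le_trans q0 up.
have -> : (1 - n * loss) `^ (- ((n - 1) / (2 * n))) =
          ((1 - n * loss)^-1) `^ ((n - 1) / (2 * n)).
  have v0 : 0 <= 1 - n * loss by rewrite -invr_ge0 ltW.
  by rewrite -(powR_inv1 v0) -powRrM mulN1r.
by rewrite !lerD2r !ge0_ler_powR// nnegrE ltW.
Qed.
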